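(* Let $C\subseteq\mathbb{R}^n$ and $\bar x\in C$. If $C$ is amenable at $\bar x$, then $C$ is smoothly approximately convex at $\bar x$.
   Context: A curve $\gamma:[a,b]\to C$ is a smooth curve segment in $C$ if it extends to a $\mathcal{C}^{(1)}$-smooth map from an open neighborhood of $[a,b]$ into $\mathbb{R}^n$. A set $C\subseteq\mathbb{R}^n$ is smoothly approximately convex at $\bar x\in C$ if for every $\epsilon>0$ there is a neighborhood $W$ of $\bar x$ such that for all $x,x'\in C\cap W$ there is a smooth curve segment $\gamma:[0,1]\to C$ with $\gamma(0)=x$, $\gamma(1)=x'$ and $\|\gamma'(t)-(x'-x)\|\le\epsilon\|x'-x\|$ for all $t\in[0,1]$. A set $C\subseteq\mathbb{R}^n$ is amenable at $\bar x\in C$ if there exist an open neighborhood $V$ of $\bar x$, a $\mathcal{C}^{(1)}$ map $F:V\to\mathbb{R}^m$ and a closed convex set $D\subseteq\mathbb{R}^m$ such that $C\cap V=\{x\in V: F(x)\in D\}$ and the only vector $y\in N_D(F(\bar x))$ with $\nabla F(\bar x)^\top y=0$ is $y=0$; here $N_D(z)=\{y:\langle y,d-z\rangle\le 0\ \forall d\in D\}$ is the normal cone of the convex set $D$. *)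

(* Defs.v *)
From HB Require Import structures.
From mathcomp Require Import all_boot all_order all_algebra.
From mathcomp Require Import all_classical all_reals all_analysis.
Set Implicit Arguments. Unset Strict Implicit. Unset Printing Implicit Defensive.
Import Order.TTheory GRing.Theory Num.Theory.
Import numFieldNormedType.Exports.
Local Open Scope classical_set_scope.
Local Open Scope ring_scope.

Definition dotv {R : realType} {n : nat} (u v : 'rV[R]_n) : R :=
  \sum_(i < n) u ord0 i * v ord0 i.
Definition enorm {R : realType} {n : nat} (u : 'rV[R]_n) : R :=
  Num.sqrt (dotv u u).

Definition C1_on {R : realType} {n m : nat} (V : set 'rV[R]_n)
    (F : 'rV[R]_n -> 'rV[R]_m) : Prop :=
  (forall x, V x -> differentiable F x) /\
  (forall x, V x -> {for x, continuous (fun y => jacobian F y)}).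

Definition C1_curve_on {R : realType} {n : nat} (U : set R)
    (g : R -> 'rV[R]_n) : Prop :=
  (forall t, U t -> derivable g t 1) /\
  (forall t, U t -> {for t, continuous (fun s => 'D_1 g s)}).

Definition normal_cone {R : realType} {m : nat} (D : set 'rV[R]_m)
    (z : 'rV[R]_m) : set 'rV[R]_m :=
  [set y | forall d, D d -> dotv y (d - z) <= 0].

(* Amenability of C at xbar. nabla F(xbar)^T y is written y *m (jacobian F xbar)^T
   (jacobian F xbar : 'M_(n,m) satisfies v *m jacobian F xbar = 'd F xbar v). *)
Definition amenable_at {R : realType} {n : nat} (C : set 'rV[R]_n)
    (xbar : 'rV[R]_n) : Prop :=
  exists (V : set 'rV[R]_n) (m : nat) (F : 'rV[R]_n -> 'rV[R]_m)
         (D : set 'rV[R]_m),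
    [/\ open V /\ V xbar, C1_on V F, closed D /\ convex_set (D : set (convex_lmodType _)),
        C `&` V = [set x | V x /\ D (F x)] &
        forall y, normal_cone D (F xbar) y ->
          y *m (jacobian F xbar)^T = 0 -> y = 0].

Definition smooth_segment_ok {R : realType} {n : nat} (C : set 'rV[R]_n)
    (eps : R) (x x' : 'rV[R]_n) : Prop :=
  exists (U : set R) (g : R -> 'rV[R]_n),
    [/\ open U /\ `[0, 1] `<=` U, C1_curve_on U g,
        (forall t, t \in `[0, 1] -> C (g t)),
        g 0 = x /\ g 1 = x' &
        forall t, t \in `[0, 1] ->
          enorm ('D_1 g t - (x' - x)) <= eps * enorm (x' - x)].

Definition smoothly_approx_convex_at {R : realType} {n : nat}
    (C : set 'rV[R]_n) (xbar : 'rV[R]_n) : Prop :=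
  forall eps : R, 0 < eps ->
    exists W : set 'rV[R]_n, nbhs xbar W /\
      forall x x', C x -> W x -> C x' -> W x' -> smooth_segment_ok C eps x x'.

(* Main.v *)
(** Let [z = F xbar] and [J = F'(xbar)]. By separation, the constraint
qualification makes the convex cone generated by the vectors [u J - (d - z)],
[d] in [D], dense, hence it contains vectors close to every [e_j] and [- e_j].
This yields finitely many [u_i] and [d_i] in [D], positive weights [a] and a matrix
[B] such that, for the rows [k_i = u_i J - (d_i - z)], [a k = 0] and [B k = 1].

To join [x] to [x'] start from the segment [x_t], add the bump
[mu(t) * sum a_i u_i] with [mu(t) = kappa |x' - x| t (1 - t)], and correct by [s B u],
where [s = s(t)] solves
[F(x_t + (mu a + s B) u) = p_t + (mu a + s B) (d - p_t)],
[p_t] being the segment from [F x] to [F x']. Since [B k = 1], the equation in [s] is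
a perturbation of the identity: contraction gives a unique small solution, and
it is C1 in [t]. Strict differentiability of [F] shows that [s] is [o(mu)], so the
weights [mu a + s B] are nonnegative, the right-hand side lies in [D], and the
derivative of the curve stays close to [x' - x]. *)

From HB Require Import structures.
Require Import Defs.
From mathcomp Require Import all_boot all_order all_algebra.
From mathcomp Require Import all_classical all_reals all_analysis.
From mathcomp Require Import ring lra.
Set Implicit Arguments.
Unset Strict Implicit.
Unset Printing Implicit Defensive.
Import Order.TTheory GRing.Theory Num.Theory.
Import numFieldNormedType.Exports.
Local Open Scope classical_set_scope.
Local Open Scope ring_scope.

(** * Maximum norm of matrices and its comparison with the Euclidean norm *)

Lemma mx_entry_le {R : realType} {m n : nat} (A : 'M[R]_(m, n)) i j :
  `|A i j| <= `|A|.
Proof.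
rewrite [leRHS]/Num.Def.normr/= mx_normrE.
exact: (le_bigmax _ (fun ij => `|A ij.1 ij.2|) (i, j)).
Qed.

Lemma mx_norm_le {R : realType} {m n : nat} (A : 'M[R]_(m, n)) (e : R) :
  0 <= e -> (forall i j, `|A i j| <= e) -> `|A| <= e.
Proof.
move=> e0 Ae; rewrite [leLHS]/Num.Def.normr/= mx_normrE.
by apply: bigmax_le => // -[i j] _; exact: Ae.
Qed.

Lemma mulmx_norm_le {R : realType} {p n q : nat}
    (v : 'M[R]_(p, n)) (A : 'M[R]_(n, q)) :
  `|v *m A| <= n%:R * `|A| * `|v|.
Proof.
apply: mx_norm_le => [|i j]; first by rewrite !mulr_ge0.
rewrite mxE (le_trans (ler_norm_sum _ _ _))//.
rewrite -mulrA mulr_natl -[X in _ *+ X]card_ord -sumr_const ler_sum// => k _.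
by rewrite normrM mulrC ler_pM// mx_entry_le.
Qed.

(** Used with [w] the image of [v] under a map close to the identity: such maps are then inverted
    with the uniform constant 2. *)
Lemma near_id_norm_le {R : realType} {V : normedModType R} (v w : V) :
  `|v - w| <= 2^-1 * `|v| -> `|v| <= 2 * `|w|.
Proof.
move=> h; have := ler_normD (v - w) w; rewrite subrK.
by move: h; lra.
Qed.

Lemma norm_le_enorm {R : realType} {n : nat} (v : 'rV[R]_n) : `|v| <= enorm v.
Proof.
apply: mx_norm_le => [|i j]; first exact: sqrtr_ge0.
rewrite ord1 -sqrtr_sqr ler_wsqrtr// /dotv (bigD1 j)//= -expr2 lerDl.
by apply: sumr_ge0 => k _; rewrite -expr2 sqr_ge0.
Qed.

Lemma enorm_le {R : realType} {n : nat} (v : 'rV[R]_n) :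
  enorm v <= n%:R * `|v|.
Proof.
rewrite -[leRHS]ger0_norm ?mulr_ge0// -sqrtr_sqr ler_wsqrtr// /dotv.
apply: (@le_trans _ _ (\sum_(i < n) `|v| ^+ 2)).
  apply: ler_sum => i _; rewrite -expr2 -[leLHS]ger0_norm ?sqr_ge0// normrX.
  by rewrite lerXn2r ?nnegrE// mx_entry_le.
rewrite sumr_const card_ord exprMn -[leLHS]mulr_natl ler_wpM2r ?sqr_ge0//.
by rewrite -natrX ler_nat; case: n {v} => // n; rewrite leq_pmulr.
Qed.

(** * Derivatives along curves, strict differentiability and first-order expansions *)

Lemma is_derive_comp_jacobian {R : realType} {n m : nat}
    (F : 'rV[R]_n -> 'rV[R]_m) (g : R -> 'rV[R]_n) (t : R) (dg : 'rV[R]_n) :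
  is_derive t 1 g dg -> differentiable F (g t) ->
  is_derive t 1 (F \o g) (dg *m jacobian F (g t)).
Proof.
move=> [dgt <-] dF; have dg' : differentiable g t by apply/derivable1_diffP.
have dFg : differentiable (F \o g) t by exact: differentiable_comp.
apply: DeriveDef; first exact/derivable1_diffP.
by rewrite deriveE// diff_comp//= /jacobian mul_rV_lin1 deriveE.
Qed.

Lemma is_derive_coord {R : realType} {m n : nat} (g : R -> 'M[R]_(m, n))
    (t : R) (dg : 'M[R]_(m, n)) i j :
  is_derive t 1 g dg -> is_derive t 1 (fun s => g s i j) (dg i j).
Proof.
move=> [dgt <-]; have /derivable_mxP dgij := dgt.
by apply: DeriveDef => //; rewrite derive_mx// mxE.
Qed.

Lemma is_derive_mulmxr {R : realType} {n m : nat} (g : R -> 'rV[R]_n)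
    (A : 'M[R]_(n, m)) (t : R) (dg : 'rV[R]_n) :
  is_derive t 1 g dg -> is_derive t 1 (fun s => g s *m A) (dg *m A).
Proof.
move=> dgt; have dij i j := is_derive_coord i j dgt.
have cE i j : (fun s => (g s *m A) i j) = \sum_(k < n) A k j \*: (fun s => g s i k).
  by apply/funext => s; rewrite mxE fct_sumE; apply: eq_bigr => k _; rewrite mulrC.
have dij' i j : is_derive t 1 (fun s => (g s *m A) i j)
    (\sum_(k < n) A k j *: dg i k).
  by rewrite cE; apply: is_derive_sum.
have dgA : derivable (fun s => g s *m A) t 1.
  by apply/derivable_mxP => i j; have [] := dij' i j.
apply: DeriveDef => //; rewrite derive_mx//; apply/matrixP => i j.
by rewrite !mxE derive_val; apply: eq_bigr => k _; rewrite mulrC.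
Qed.

Lemma is_derive_segment {R : realType} {n : nat} (x v : 'rV[R]_n) (t : R) :
  is_derive t 1 (fun s : R => x + s *: v) v.
Proof.
have dv : is_derive t (1 : R) (fun s : R => s *: v) v.
  have dd : is_diff t (fun s : R => s *: v) ( *:%R^~ v) by exact: is_diff_scalel.
  have df : differentiable (fun s : R => s *: v) t by [].
  apply: DeriveDef; first exact/derivable1_diffP.
  by rewrite deriveE// diff_val scale1r.
rewrite -[X in is_derive _ _ _ X]add0r.
by apply: (is_deriveD (f := cst x)).
Qed.

(** The mean value theorem is applied to each coordinate of [F (z + t *: v) - t *: v *m J] on the
    segment from [z] to [y], which stays in the ball where the Jacobian is close to [J]. *)
Lemma C1_strictly_differentiable {R : realType} {n m : nat}
    (V : set 'rV[R]_n) (F : 'rV[R]_n -> 'rV[R]_m) (x : 'rV[R]_n) (w : R) :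
  open V -> V x -> C1_on V F -> 0 < w ->
  exists2 d : R, 0 < d &
    (forall y : 'rV[R]_n, `|y - x| < d ->
       V y /\ forall v : 'rV[R]_n, `|v *m (jacobian F y - jacobian F x)| <= w * `|v|) /\
    (forall y z : 'rV[R]_n, `|y - x| < d -> `|z - x| < d ->
       `|F y - F z - (y - z) *m jacobian F x| <= w * `|y - z|).
Proof.
move=> oV Vx [dF cJ] w0; set J := jacobian F x.
(* Absorbs the factor [n] of [mulmx_norm_le]; the [+ 1] covers [n = 0]. *)
have e0 : 0 < w / (n%:R + 1) by rewrite divr_gt0// ltr_wpDl.
have /cvgrPdist_le/(_ _ e0) cJx := cJ x Vx.
have : \forall y \near x, V y /\ `|J - jacobian F y| <= w / (n%:R + 1).
  near=> y; split; last by near: y; exact: cJx.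
  by near: y; exact: open_nbhs_nbhs.
move=> /nbhs_normP[d /= d0 dP]; exists d => //.
have P1 (y : 'rV[R]_n) : `|y - x| < d ->
    V y /\ forall v : 'rV[R]_n, `|v *m (jacobian F y - J)| <= w * `|v|.
  move=> yx; have [Vy Jy] := dP y (eq_ind _ (fun z => z < d) yx _ (distrC _ _)).
  split=> // v; rewrite (le_trans (mulmx_norm_le _ _))// ler_wpM2r//.
  rewrite distrC (le_trans (ler_wpM2l _ Jy))// mulrCA ler_piMr ?(ltW w0)//.
  by rewrite ler_pdivrMr ?mul1r ?lerDl// ltr_wpDl.
split=> // y z yd zd; set v : 'rV[R]_n := y - z.
apply: mx_norm_le => [|i j]; first by rewrite mulr_ge0// ltW.
have pt (t : R) : 0 <= t <= 1 -> `|z + t *: v - x| < d.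
  move=> /andP[t0 t1].
  have -> : z + t *: v - x = t *: (y - x) + (1 - t) *: (z - x).
    by apply/matrixP => a b; rewrite /v !mxE; ring.
  rewrite (le_lt_trans (ler_normD _ _))// !normrZ !ger0_norm ?subr_ge0//.
  have Md : Num.max `|y - x| `|z - x| < d by rewrite gt_max yd zd.
  apply: le_lt_trans Md.
  rewrite (_ : Num.max _ _ = t * Num.max `|y - x| `|z - x| +
    (1 - t) * Num.max `|y - x| `|z - x|); last by ring.
  by rewrite lerD// ler_wpM2l ?subr_ge0// le_max lexx ?orbT.
pose f (t : R) := (F (z + t *: v) - t *: v *m J) i j.
pose df (t : R) := (v *m (jacobian F (z + t *: v) - J)) i j.
have fd (t : R) : 0 <= t <= 1 -> is_derive t 1 f (df t).
  move=> t01; apply: is_derive_coord; rewrite mulmxBr.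
  have [Vt _] := P1 _ (pt t t01).
  have dFv := is_derive_comp_jacobian (is_derive_segment z v t) (dF _ Vt).
  have dvJ : is_derive t 1 (fun s : R => s *: v *m J) (v *m J).
    apply: is_derive_mulmxr.
    by have := is_derive_segment 0 v t; under eq_fun do rewrite add0r.
  exact: (is_deriveB dFv dvJ).
have [| |c] := @MVT_segment R f df 0 1 ler01.
- move=> t; rewrite in_itv/= => /andP[t0 t1]; apply: fd.
  by rewrite !ltW.
- apply: derivable_within_continuous => t; rewrite in_itv/= => t01.
  by have [] := fd t t01.
rewrite in_itv/= => c01; rewrite subr0 mulr1 /f scale1r scale0r mul0mx subr0 addr0.
rewrite (_ : z + v = y) => [fE|]; last by rewrite /v addrC subrK.
have -> : (F y - F z - v *m J) i j = df c by rewrite -fE !mxE; ring.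
by rewrite (le_trans (mx_entry_le _ _ _))//; have [_] := P1 _ (pt c c01); exact.
Unshelve. all: by end_near. Qed.

Lemma differentiable_near {R : realType} {n m : nat}
    (F : 'rV[R]_n -> 'rV[R]_m) (x : 'rV[R]_n) (e : R) :
  differentiable F x -> 0 < e ->
  \forall y \near x, `|F y - F x - (y - x) *m jacobian F x| <= e * `|y - x|.
Proof.
move=> dF e0; have /diff_locally/eqaddoP/= H := dF.
have /nbhs_normP[d /= d0 dP] := H e e0.
apply/nbhs_normP; exists d => //= y; rewrite /ball_/= distrC => yx.
have := dP (y - x); rewrite /= sub0r normrN => /(_ yx).
by rewrite !fctE/= subrK opprD addrA mul_rV_lin1.
Qed.

Lemma is_derive_near {R : realType} {V : normedModType R} (f : R -> V)
    (t : R) (l : V) (e : R) :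
  is_derive t 1 f l -> 0 < e ->
  \forall s \near t, `|f s - f t - (s - t) *: l| <= e * `|s - t|.
Proof.
move=> [dft <-] e0; have df : differentiable f t by apply/derivable1_diffP.
have /diff_locally/eqaddoP/= H := df.
have /nbhs_normP[d /= d0 dP] := H e e0.
apply/nbhs_normP; exists d => //= s; rewrite /ball_/= distrC => st.
have := dP (s - t); rewrite /= sub0r normrN => /(_ st).
rewrite !fctE/= subrK opprD addrA.
by rewrite -(deriveE _ df) -[X in 'D_X f t](mulr1 (s - t)) !deriveE// linearZ.
Qed.

(** Converse of [is_derive_near], by dividing the expansion by the increment; it reduces
    differentiability to norm estimates. *)
Lemma near_is_derive {R : realType} {V : normedModType R} (f : R -> V)
    (t : R) (l : V) :
  (forall e : R, 0 < e ->
     \forall s \near t, `|f s - f t - (s - t) *: l| <= e * `|s - t|) ->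
  is_derive t 1 f l.
Proof.
move=> H.
have cf : h^-1 *: (f (h *: (1 : R) + t) - f t) @[h --> 0^'] --> l.
  apply/cvgrPdist_le => e e0; have /nbhs_normP[d /= d0 dP] := H e e0.
  near=> h.
  have h0 : h != 0 by near: h; exact: nbhs_dnbhs_neq.
  have hd : `|h| < d by near: h; exact: dnbhs0_lt.
  have := dP (h *: (1 : R) + t); rewrite /= scaler1 addrK.
  rewrite opprD addrCA subrr addr0 normrN => /(_ hd) hP.
  have -> : l - h^-1 *: (f (h + t) - f t) =
      - (h^-1 *: (f (h + t) - f t - h *: l)).
    by rewrite [in RHS]scalerBr scalerA mulVf// scale1r opprB.
  rewrite normrN normrZ normfV mulrC ler_pdivrMr ?normr_gt0//.
by apply: DeriveDef; [apply/cvg_ex; exists l|exact: cvg_lim].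
Unshelve. all: by end_near. Qed.

Lemma cvg_mulmx {R : realType} {T : Type} {p n q : nat} (G : set_system T)
    {FG : Filter G} (f : T -> 'M[R]_(p, n)) (g : T -> 'M[R]_(n, q))
    (a : 'M[R]_(p, n)) (b : 'M[R]_(n, q)) :
  f x @[x --> G] --> a -> g x @[x --> G] --> b ->
  f x *m g x @[x --> G] --> a *m b.
Proof.
move=> fa gb; rewrite -(@subr_cvg0 _ _ _ G); apply/norm_cvg0P.
pose h x := n%:R * `|g x| * `|f x - a| + n%:R * `|g x - b| * `|a|.
apply: (@squeeze_cvgr _ _ _ _ (cst 0) h).
- apply: nearW => x; rewrite normr_ge0/= /h.
  have -> : f x *m g x - a *m b = (f x - a) *m g x + a *m (g x - b).
    by rewrite mulmxBl mulmxBr addrA subrK.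
  by rewrite (le_trans (ler_normD _ _))// lerD// mulmx_norm_le.
- exact: cvg_cst.
- have -> : (0 : R) = n%:R * `|b| * 0 + n%:R * 0 * `|a| by rewrite !(mulr0, mul0r) addr0.
  apply: cvgD; apply: cvgM.
  + by apply: cvgM; [exact: cvg_cst|exact: cvg_norm].
  + by apply/norm_cvg0P/subr_cvg0.
  + by apply: cvgM; [exact: cvg_cst|apply/norm_cvg0P/subr_cvg0].
  + exact: cvg_cst.
Qed.

(** * Completeness and contractions *)

HB.instance Definition _ (R : realType) (m n : nat) :=
  Complete.on 'M[R]_(m, n).

(** The ball of radius [r] is mapped into itself because [|f u| <= |u| / 2 + |f 0|], so Banach's
    theorem applies there; the bound follows from [|p - f 0| <= |p| / 2]. *)
Lemma half_contraction_fixpoint {R : realType} {X : completeNormedModType R}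
    (f : X -> X) (r : R) :
  `|f 0| <= r / 2 ->
  (forall u v, `|u| <= r -> `|v| <= r -> `|f u - f v| <= 2^-1 * `|u - v|) ->
  exists2 p, f p = p & `|p| <= 2 * `|f 0|.
Proof.
move=> f0 fL; have r0 : 0 <= r by have := normr_ge0 (f 0); lra.
pose U : set X := [set u | `|u| <= r].
have fU : set_fun U U f.
  move=> u; rewrite /U/= => ur; have := fL u 0 ur; rewrite normr0 subr0 => /(_ r0) fu.
  have := ler_normD (f u - f 0) (f 0); rewrite subrK /U/=.
  by move: ur fu f0; lra.
pose g : {fun U >-> U} := HB.pack f (isFun.Build _ _ _ _ f fU).
have gc : is_contraction g.
  exists 2^-1%:nng; split=> /=; first by lra.
  by move=> [u v] [/= Uu Uv]; exact: fL.
have cU : closed U.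
  have -> : U = (fun u : X => `|u|) @^-1` [set x : R | x <= r] by [].
  by apply: closed_comp; [move=> u _; exact: norm_continuous|exact: closed_le].
have [|p Up pE] := banach_fixed_point gc cU; first by exists 0; rewrite /U/= normr0.
exists p => //; have := fL p 0 Up; rewrite normr0 => /(_ r0).
rewrite subr0 -[f p]/(g p) -pE => h; apply: near_id_norm_le.
exact: h.
Qed.

Lemma unitmx_of_norm_le {R : realType} {m : nat} (A : 'M[R]_m) :
  (forall v : 'rV[R]_m, `|v| <= 2 * `|v *m A|) -> A \in unitmx.
Proof.
move=> H; rewrite -row_free_unit; apply/inj_row_free => v vA.
by apply/normr0_eq0/eqP; rewrite eq_le normr_ge0 andbT (le_trans (H v))// vA normr0 mulr0.
Qed.

(** * The implicit equation [F (c + s N) = q + s E] and its C1 solution curve *)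

Section implicit_curve.
Variables (R : realType) (n m : nat) (F : 'rV[R]_n -> 'rV[R]_m).
Variables (J : 'M[R]_(n, m)) (N : 'M[R]_(m, n)) (E : 'M[R]_m).
Variables (B : set 'rV[R]_n) (w nu : R).
Hypothesis w0 : 0 <= w.
Hypothesis nu0 : 0 <= nu.
Hypothesis nuP : forall s : 'rV[R]_m, `|s *m N| <= nu * `|s|.
Hypothesis wnu : w * nu <= 2^-1.
Hypothesis NJE : N *m J - E = 1%:M.
Hypothesis FJ : forall y, B y ->
  [/\ differentiable F y, {for y, continuous (fun z => jacobian F z)} &
      forall v : 'rV[R]_n, `|v *m (jacobian F y - J)| <= w * `|v|].
Hypothesis Fstrict : forall y z : 'rV[R]_n, B y -> B z ->
  `|F y - F z - (y - z) *m J| <= w * `|y - z|.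

Let wN (s : 'rV[R]_m) : w * `|s *m N| <= 2^-1 * `|s|.
Proof.
rewrite (le_trans (ler_wpM2l w0 (nuP s)))// mulrA ler_wpM2r//.
Qed.

(** The solution is a fixed point of [s - (F (c + s N) - q - s E)]. As [N J - E = 1], two values of
    this map differ by minus a linearization error of [F], and [wnu] makes it a half contraction. *)
Lemma implicit_point (c : 'rV[R]_n) (q : 'rV[R]_m) (r : R) :
  2 * `|F c - q| <= r -> (forall s : 'rV[R]_m, `|s| <= r -> B (c + s *m N)) ->
  exists2 s : 'rV[R]_m, F (c + s *m N) = q + s *m E & `|s| <= 2 * `|F c - q|.
Proof.
move=> Fcq cB.
pose f (s : 'rV[R]_m) := s - (F (c + s *m N) - q - s *m E).
have f0 : f 0 = - (F c - q) by rewrite /f !mul0mx subr0 addr0 sub0r.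
have fL u v : `|u| <= r -> `|v| <= r -> `|f u - f v| <= 2^-1 * `|u - v|.
  move=> /cB Bu /cB Bv.
  have -> : f u - f v =
      - (F (c + u *m N) - F (c + v *m N) - (c + u *m N - (c + v *m N)) *m J).
    have -> : (c + u *m N - (c + v *m N)) *m J = (u - v) + (u - v) *m E.
      rewrite opprD addrACA subrr add0r -mulmxBl -mulmxA.
      by rewrite -[N *m J](subrK E) NJE mulmxDr mulmx1.
    rewrite /f; apply/matrixP => i j; rewrite mulmxBl !mxE.
    by ring.
  rewrite normrN (le_trans (Fstrict Bu Bv))//.
  by rewrite opprD addrACA subrr add0r -mulmxBl.
have [||s fs sle] := @half_contraction_fixpoint R 'rV[R]_m f r.
- by rewrite f0 normrN; lra.
- exact: fL.
exists s; last by move: sle; rewrite f0 normrN.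
move: fs; rewrite /f => /eqP; rewrite subr_eq addrC -subr_eq subrr eq_sym.
by rewrite -addrA -opprD subr_eq0 => /eqP.
Qed.

(** The matrix differs from [N *m J - E = 1] by one that at most halves norms. *)
Lemma implicit_jacobian_norm (y : 'rV[R]_n) (v : 'rV[R]_m) : B y ->
  `|v| <= 2 * `|v *m (N *m jacobian F y - E)|.
Proof.
move=> /FJ[_ _ H]; apply: near_id_norm_le.
rewrite -[X in `|X - _|](mulmx1 v) -NJE -mulmxBr.
have -> : N *m J - E - (N *m jacobian F y - E) = - (N *m (jacobian F y - J)).
  by rewrite mulmxBr opprB opprB addrA subrK.
by rewrite mulmxN normrN mulmxA (le_trans (H _)).
Qed.

Variables (U : set R) (c dc : R -> 'rV[R]_n) (q dq s : R -> 'rV[R]_m).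
Hypothesis oU : open U.
Hypothesis cU : forall t, U t -> is_derive t 1 c (dc t).
Hypothesis qU : forall t, U t -> is_derive t 1 q (dq t).
Hypothesis dcU : forall t, U t -> {for t, continuous dc}.
Hypothesis dqU : forall t, U t -> {for t, continuous dq}.
Let g (t : R) := c t + s t *m N.
Hypothesis gB : forall t, U t -> B (g t).
Hypothesis Fg : forall t, U t -> F (g t) = q t + s t *m E.

Let L (t : R) := N *m jacobian F (g t) - E.
(** Obtained by implicit differentiation of [F (g t) = q t + s t *m E]. *)
Let ds (t : R) := (dq t - dc t *m jacobian F (g t)) *m invmx (L t).

Let LP t : U t -> L t \in unitmx.
Proof.
by move=> /gB Bt; apply: unitmx_of_norm_le => v; exact: implicit_jacobian_norm.
Qed.

Let dsL t : U t -> ds t *m L t = dq t - dc t *m jacobian F (g t).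
Proof. by move=> Ut; rewrite /ds mulmxKV// LP. Qed.

Let near_U t : U t -> \forall t' \near t, U t'.
Proof. by move=> Ut; apply: open_nbhs_nbhs. Qed.

Let is_derive_lip {k : nat} (f : R -> 'rV[R]_k) (t : R) (l : 'rV[R]_k) :
  is_derive t 1 f l ->
  \forall t' \near t, `|f t' - f t| <= (`|l| + 1) * `|t' - t|.
Proof.
move=> /is_derive_near/(_ ltr01); apply: filterS => t'.
rewrite mul1r => h; have := ler_normD (f t' - f t - (t' - t) *: l) ((t' - t) *: l).
by rewrite subrK normrZ; move: h; nra.
Qed.

(** The identity [N J - E = 1] isolates [s t' - s t] up to a linearization error, in which
    [|s t' - s t|] comes back with factor 1/2 and is absorbed. This bound lets errors relative to
    [g] be read as errors relative to [t]. *)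
Let s_lip t : U t -> exists2 K : R, 0 < K &
  \forall t' \near t, `|s t' - s t| <= K * `|t' - t|.
Proof.
move=> Ut; have lc := is_derive_lip (cU Ut); have lq := is_derive_lip (qU Ut).
pose k1 := `|dc t| + 1; pose k2 := `|dq t| + 1; pose k3 := n%:R * `|J|.
have k30 : 0 <= k3 by rewrite mulr_ge0.
have k10 : 0 < k1 by rewrite ltr_wpDl.
have k20 : 0 < k2 by rewrite ltr_wpDl.
exists (2 * (k2 + k3 * k1 + w * k1)).
  have := mulr_ge0 k30 (ltW k10); have := mulr_ge0 w0 (ltW k10).
  by move: k20; lra.
near=> t'.
have Ut' : U t' by near: t'; exact: near_U.
have hc : `|c t' - c t| <= k1 * `|t' - t| by near: t'; exact: lc.
have hq : `|q t' - q t| <= k2 * `|t' - t| by near: t'; exact: lq.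
have gE : g t' - g t = (c t' - c t) + (s t' - s t) *m N.
  by rewrite /g opprD addrACA -mulmxBl.
have sE : s t' - s t = (q t' - q t) - (c t' - c t) *m J -
    (F (g t') - F (g t) - (g t' - g t) *m J).
  rewrite gE !Fg//; set D := s t' - s t.
  have DE : s t' *m E = s t *m E + D *m E by rewrite /D mulmxBl addrC subrK.
  rewrite DE [(_ + D *m N) *m J]mulmxDl -[D *m N *m J]mulmxA -[N *m J](subrK E) NJE mulmxDr mulmx1.
  by apply/matrixP => i j; rewrite !mxE; ring.
have hst := Fstrict (gB Ut') (gB Ut).
have hJ := mulmx_norm_le (c t' - c t) J; rewrite -/k3 in hJ.
have hg : w * `|g t' - g t| <= w * `|c t' - c t| + 2^-1 * `|s t' - s t|.
  rewrite gE (le_trans (ler_wpM2l w0 (ler_normD _ _)))// mulrDr lerD2l.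
  exact: wN.
have : `|s t' - s t| <= `|q t' - q t| + k3 * `|c t' - c t| + w * `|g t' - g t|.
  rewrite {1}sE (le_trans (ler_normB _ _))// lerD//.
  by rewrite (le_trans (ler_normB _ _))// lerD.
have := ler_wpM2l k30 hc; have := ler_wpM2l w0 hc.
move: hq hg; rewrite !mulrA.
move: `|s t' - s t| `|g t' - g t| `|c t' - c t| `|q t' - q t| => a1 a2 a3 a4.
by lra.
Unshelve. all: by end_near. Qed.

(** The remainder of [s], multiplied by [L t], is a combination of the remainders of [q], [c] and
    [F], all small relative to [|t' - t|]; [L t] is bounded below, so the remainder is small too. *)
Let is_derive_s t : U t -> is_derive t 1 s (ds t).
Proof.
move=> Ut; apply: near_is_derive => e e0.
have [K K0 Ks] := s_lip Ut.
have lc := is_derive_lip (cU Ut); set k1 := `|dc t| + 1 in lc.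
have k10 : 0 < k1 by rewrite ltr_wpDl.
pose Kg := k1 + nu * K.
have Kg0 : 0 < Kg by rewrite ltr_wpDr// mulr_ge0// ltW.
pose J0 := jacobian F (g t); pose k3 := n%:R * `|J0|.
have k30 : 0 <= k3 by rewrite mulr_ge0.
(* Makes the three remainders, times the constant 2 for inverting [L t], add up to [e]. *)
pose e1 := e / (2 * (1 + k3 + Kg)).
have e10 : 0 < e1 by rewrite divr_gt0// mulr_gt0//; lra.
have e1E : 2 * (e1 + k3 * e1 + e1 * Kg) = e.
  by rewrite /e1; field; apply: lt0r_neq0; lra.
have [dF _ _] := FJ (gB Ut).
have /nbhs_normP[d /= d0 dP] := differentiable_near dF e10.
have nc := is_derive_near (cU Ut) e10; have nq := is_derive_near (qU Ut) e10.
near=> t'.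
have Ut' : U t' by near: t'; exact: near_U.
have hc : `|c t' - c t| <= k1 * `|t' - t| by near: t'; exact: lc.
have hs : `|s t' - s t| <= K * `|t' - t| by near: t'; exact: Ks.
have hdc : `|c t' - c t - (t' - t) *: dc t| <= e1 * `|t' - t| by near: t'; exact: nc.
have hdq : `|q t' - q t - (t' - t) *: dq t| <= e1 * `|t' - t| by near: t'; exact: nq.
have hd : `|t' - t| < d / Kg.
  rewrite distrC; near: t'; apply/nbhs_normP.
  by exists (d / Kg); rewrite /= ?divr_gt0.
have gE : g t' - g t = (c t' - c t) + (s t' - s t) *m N.
  by rewrite /g opprD addrACA -mulmxBl.
have hg : `|g t' - g t| <= Kg * `|t' - t|.
  rewrite gE (le_trans (ler_normD _ _))// /Kg mulrDl lerD//.
  by rewrite (le_trans (nuP _))// -mulrA ler_wpM2l.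
have herr : `|F (g t') - F (g t) - (g t' - g t) *m J0| <= e1 * (Kg * `|t' - t|).
  apply: le_trans (ler_wpM2l (ltW e10) hg); apply: dP.
  by rewrite /ball_/= distrC (le_lt_trans hg)// mulrC -ltr_pdivlMr.
have sE : (s t' - s t - (t' - t) *: ds t) *m L t =
    (q t' - q t - (t' - t) *: dq t) - (c t' - c t - (t' - t) *: dc t) *m J0 -
    (F (g t') - F (g t) - (g t' - g t) *m J0).
  rewrite mulmxBl -scalemxAl dsL// -/J0 gE !Fg//; set D := s t' - s t.
  have DE : s t' *m E = s t *m E + D *m E by rewrite /D mulmxBl addrC subrK.
  rewrite DE [(_ + D *m N) *m J0]mulmxDl /L -/J0 mulmxBr mulmxA [(_ - _ *: dc t) *m J0]mulmxBl -scalemxAl.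
  by apply/matrixP => i j; rewrite !mxE; ring.
rewrite (le_trans (implicit_jacobian_norm _ (gB Ut)))// -/(L t) sE.
rewrite -e1E -mulrA ler_wpM2l// (le_trans (ler_normB _ _))// !mulrDl lerD//.
  rewrite (le_trans (ler_normB _ _))// lerD// -mulrA.
  by rewrite (le_trans (mulmx_norm_le _ _))// ler_wpM2l.
by rewrite -mulrA.
Unshelve. all: by end_near. Qed.

Let is_derive_g t : U t -> is_derive t 1 g (dc t + ds t *m N).
Proof.
move=> Ut; have h1 := is_derive_mulmxr N (is_derive_s Ut).
exact: (is_deriveD (cU Ut) h1).
Qed.

Let continuous_Jg t : U t -> {for t, continuous (fun t' => jacobian F (g t'))}.
Proof.
move=> Ut; have [dg _] := is_derive_g Ut.
have cg : {for t, continuous g}.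
  exact/differentiable_continuous/derivable1_diffP.
by have [_ cJ _] := FJ (gB Ut); exact: continuous_comp cg cJ.
Qed.

(** With [W] the right-hand side of the system for [ds], [(ds t' - ds t) L t' = (W t' - W t) - ds t
    (L t' - L t)] tends to 0, and the lower bound on [L t'] is uniform in [t']. *)
Let continuous_ds t : U t -> {for t, continuous ds}.
Proof.
move=> Ut.
have cJ : jacobian F (g t') @[t' --> t] --> jacobian F (g t) by exact: continuous_Jg.
pose W t' := dq t' - dc t' *m jacobian F (g t').
have cW : W t' @[t' --> t] --> W t.
  by apply: cvgB; [exact: dqU|apply: cvg_mulmx => //; exact: dcU].
have cL : L t' @[t' --> t] --> L t.
  by apply: cvgB; [apply: cvg_mulmx => //; exact: cvg_cst|exact: cvg_cst].
have cWB : W t' - W t @[t' --> t] --> W t - W t by exact: cvgB cW (cvg_cst _).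
have cLB : L t' - L t @[t' --> t] --> L t - L t by exact: cvgB cL (cvg_cst _).
have cdL : ds t *m (L t' - L t) @[t' --> t] --> ds t *m (L t - L t).
  by apply: cvg_mulmx cLB; exact: cvg_cst.
have cX : W t' - W t - ds t *m (L t' - L t) @[t' --> t] --> (0 : 'rV[R]_m).
  rewrite (_ : 0 = W t - W t - ds t *m (L t - L t)); last first.
    by rewrite !subrr mulmx0 subr0.
  exact: cvgB cWB cdL.
apply/cvgrPdist_le => e e0.
have /cvgr0Pnorm_le/(_ _ (divr_gt0 e0 (ltr0n R 2))) nh := cX.
near=> t'.
have Ut' : U t' by near: t'; exact: near_U.
have : `|W t' - W t - ds t *m (L t' - L t)| <= e / 2 by near: t'; exact: nh.
rewrite ler_pdivlMr// mulrC; apply: le_trans.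
rewrite distrC (le_trans (implicit_jacobian_norm _ (gB Ut')))// -/(L t').
have E1 (a b : 'rV[R]_m) (A A' : 'M[R]_m) :
    (a - b) *m A = a *m A - b *m A' - b *m (A - A').
  by rewrite mulmxBl mulmxBr -[RHS]addrA -opprD addrCA subrr addr0.
have h1 : ds t *m L t = W t by exact: dsL.
have h2 : ds t' *m L t' = W t' by exact: dsL.
move: h1 h2; move: (ds t) (ds t') (L t) (L t') (W t) (W t') => a b A A' u u' <- <-.
by rewrite (E1 _ _ _ A).
Unshelve. all: by end_near. Qed.

Lemma implicit_curve_C1 : C1_curve_on U g.
Proof.
split=> t Ut; first by have [] := is_derive_g Ut.
have cg : (dc t' + ds t' *m N) @[t' --> t] --> dc t + ds t *m N.
  apply: cvgD; first exact: dcU.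
  by apply: cvg_mulmx; [exact: continuous_ds|exact: cvg_cst].
have Dg t' : U t' -> 'D_1 g t' = dc t' + ds t' *m N.
  by move=> Ut'; have [] := is_derive_g Ut'.
suff : 'D_1 g t' @[t' --> t] --> 'D_1 g t by [].
rewrite (Dg t Ut).
apply: cvg_trans cg; apply: near_eq_cvg.
near=> t'; have Ut' : U t' by near: t'; exact: near_U.
by rewrite Dg.
Unshelve. all: by end_near. Qed.

(** The difference is [ds t *m N], and [ds t] solves a system whose matrix is bounded below by
    1/2. *)
Lemma implicit_curve_derive t : U t ->
  `|'D_1 g t - dc t| <= nu * (2 * `|dq t - dc t *m jacobian F (g t)|).
Proof.
move=> Ut; have [_ ->] := is_derive_g Ut.
rewrite [dc t + _]addrC addrK (le_trans (nuP _))// ler_wpM2l//.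
rewrite -(dsL Ut); exact: implicit_jacobian_norm (gB Ut).
Qed.

End implicit_curve.

(** * Inner product and nearest points *)

Lemma dotvE {R : realType} {n : nat} (u v : 'rV[R]_n) :
  dotv u v = (u *m v^T) ord0 ord0.
Proof. by rewrite mxE; apply: eq_bigr => i _; rewrite mxE. Qed.

Lemma dotvC {R : realType} {n : nat} (u v : 'rV[R]_n) : dotv u v = dotv v u.
Proof. by apply: eq_bigr => i _; rewrite mulrC. Qed.

Lemma dotvDl {R : realType} {n : nat} (u v w : 'rV[R]_n) :
  dotv (u + v) w = dotv u w + dotv v w.
Proof. by rewrite !dotvE mulmxDl mxE. Qed.

Lemma dotvZl {R : realType} {n : nat} (a : R) (u w : 'rV[R]_n) :
  dotv (a *: u) w = a * dotv u w.
Proof. by rewrite !dotvE -scalemxAl mxE. Qed.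

Lemma dotvNl {R : realType} {n : nat} (u w : 'rV[R]_n) :
  dotv (- u) w = - dotv u w.
Proof. by rewrite -scaleN1r dotvZl mulN1r. Qed.

Lemma dotv_sqrB {R : realType} {n : nat} (t : R) (l y : 'rV[R]_n) :
  dotv (t *: l - y) (t *: l - y) =
  t * (t * dotv l l - 2 * dotv l y) + dotv (- y) (- y).
Proof.
rewrite dotvDl dotvZl dotvNl (dotvC l) (dotvC y) !dotvDl !dotvZl !dotvNl.
by rewrite (dotvC y (- y)) dotvNl (dotvC y l); ring.
Qed.

Lemma dotv_mulmx {R : realType} {n m : nat} (u : 'rV[R]_n) (A : 'M[R]_(n, m))
    (y : 'rV[R]_m) : dotv (u *m A) y = dotv u (y *m A^T).
Proof. by rewrite !dotvE trmx_mul trmxK mulmxA. Qed.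

Lemma dotvv_ge0 {R : realType} {n : nat} (u : 'rV[R]_n) : 0 <= dotv u u.
Proof. by apply: sumr_ge0 => i _; rewrite -expr2 sqr_ge0. Qed.

Lemma dotvv_le0 {R : realType} {n : nat} (u : 'rV[R]_n) : dotv u u <= 0 -> u = 0.
Proof.
move=> u0; apply/normr0_eq0/eqP; rewrite eq_le normr_ge0 andbT.
by rewrite (le_trans (norm_le_enorm u))// /enorm ler0_sqrtr.
Qed.

Lemma continuous_dotvv {R : realType} {n : nat} (w : 'rV[R]_n) :
  continuous (fun u : 'rV[R]_n => dotv (u - w) (u - w)).
Proof.
apply: continuous_big => [|i _ u]; first exact: add_continuous.
have cc : (u - w) ord0 i @[u --> u] --> (u - w) ord0 i.
  have -> : (fun u : 'rV[R]_n => (u - w) ord0 i) = (fun u => u ord0 i - w ord0 i).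
    by apply/funext => z; rewrite !mxE.
  by rewrite !mxE; exact: cvgB (@coord_continuous R 1 n ord0 i u) (cvg_cst _).
exact: (cvgM cc cc).
Qed.

(** The points of [A] at least as close to [w] as [a] form a compact set, on which the squared
    distance attains its minimum. *)
Lemma nearest_point {R : realType} {n : nat} (A : set 'rV[R]_n) (w : 'rV[R]_n) :
  closed A -> A !=set0 ->
  exists2 k, A k & forall x, A x -> dotv (k - w) (k - w) <= dotv (x - w) (x - w).
Proof.
move=> cA [a Aa]; pose M := enorm (a - w).
pose f (u : 'rV[R]_n) := dotv (u - w) (u - w).
pose B := A `&` [set u | f u <= f a].
have cB : closed B.
  apply: closedI => //.
  have -> : [set u | f u <= f a] = f @^-1` [set x : R | x <= f a] by [].
  by apply: closed_comp; [move=> u _; exact: continuous_dotvv|exact: closed_le].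
have bB : bounded_set B.
  exists (M + `|w|); split; first exact: num_real.
  move=> K KM u [_ /= fu]; apply/ltW/(le_lt_trans _ KM).
  rewrite -[u](subrK w) (le_trans (ler_normD _ _))// lerD2r.
  by rewrite (le_trans (norm_le_enorm _))// ler_wsqrtr.
have [||k] := @EVT_min_rV R n f B _ (bounded_closed_compact bB cB).
- by exists a; split => //=.
- by apply: continuous_subspaceT; exact: continuous_dotvv.
rewrite inE => -[Ak fk] kmin; exists k => // x Ax.
have [xa|xa] := leP (f x) (f a); first by apply: kmin; rewrite inE.
exact: le_trans fk (ltW xa).
Qed.

Lemma closure_dist {R : realType} {n : nat} (A : set 'rV[R]_n) (x : 'rV[R]_n) :
  closure A x <-> forall e : R, 0 < e -> exists2 k, A k & `|x - k| < e.
Proof.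
split=> [Ax e e0|H B /nbhs_normP[e /= e0 eB]].
  have /Ax[k [Ak]] := nbhsx_ballx x e e0.
  by rewrite -ball_normE => xk; exists k.
by have [k Ak xk] := H e e0; exists k; split => //; exact: eB.
Qed.

(** * Density of the cone given by the constraint qualification *)

Definition convex_stable {R : realType} {m : nat} (D : set 'rV[R]_m) :=
  forall (x y : 'rV[R]_m) (t : R), 0 <= t <= 1 -> D x -> D y ->
    D (t *: x + (1 - t) *: y).

(* No nonzero functional is nonpositive on the convex cone generated by the
   [u *m J - (d - z)], so this cone is dense. *)
Lemma constraint_qualification_dense {R : realType} {n m : nat}
    (D : set 'rV[R]_m) (z : 'rV[R]_m) (J : 'M[R]_(n, m)) :
  convex_stable D -> D z ->
  (forall y, normal_cone D z y -> y *m J^T = 0 -> y = 0) ->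
  forall (w : 'rV[R]_m) (e : R), 0 < e ->
  exists p : R * 'rV[R]_n * 'rV[R]_m,
    [/\ 0 < p.1.1, D p.2 & `|w - p.1.1 *: (p.1.2 *m J - (p.2 - z))| < e].
Proof.
move=> cD Dz cq w.
pose K := [set k | exists p : R * 'rV[R]_n * 'rV[R]_m,
  [/\ 0 < p.1.1, D p.2 & k = p.1.1 *: (p.1.2 *m J - (p.2 - z))]].
have KD k l : K k -> K l -> K (k + l).
  move=> [[[r u] d] [/= r0 Dd ->]] [[[r' u'] d'] [/= r'0 Dd' ->]].
  have rr : 0 < r + r' by rewrite addr_gt0.
  have rn := lt0r_neq0 rr.
  (* The sum is one generator scaled by [r + r'], with [u] and [d] averaged in the shares [t] and
     [1 - t]; convexity of [D] enters here. *)
  pose t := r / (r + r').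
  have t1 : 1 - t = r' / (r + r') by rewrite /t; field.
  exists (r + r', t *: u + (1 - t) *: u', t *: d + (1 - t) *: d'); split=> //=.
    apply: cD => //; apply/andP; split; first by rewrite divr_ge0 ?ltW.
    by rewrite ler_pdivrMr// mul1r lerDl ltW.
  rewrite mulmxDl -!scalemxAl t1 /t.
  by apply/matrixP => i j; rewrite !mxE; field.
have KZ r k : 0 < r -> K k -> K (r *: k).
  move=> r0 [[[r' u] d] [/= r'0 Dd ->]].
  by exists (r * r', u, d); split=> //=; rewrite ?mulr_gt0// scalerA.
have K0 : closure K !=set0.
  exists 0; apply: subset_closure; exists (1, 0, z); split=> //=.
  by rewrite mul0mx !subrr scaler0.
suff : closure K w.
  move=> /closure_dist H e /H[k [p [p0 Dp ->]] wk]; by exists p.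
have [k Kk kmin] := nearest_point w (@closed_closure _ K) K0.
(* The residual [y] will be polar to [K], and the qualification then forces [y = 0]. *)
pose y := w - k.
have Ky l : K l -> dotv l y <= 0.
  move=> Kl.
  (* The point [k + t l] stays in the closure of [K], so it is no closer to [w] than [k]. *)
  have Kt t : 0 < t -> 2 * dotv l y <= t * dotv l l.
    move=> t0; have : closure K (k + t *: l).
      apply/closure_dist => e e0; have /closure_dist/(_ e e0)[k' Kk' kk'] := Kk.
      exists (k' + t *: l); first by apply: KD => //; exact: KZ.
      by rewrite opprD addrACA subrr addr0.
    move=> /kmin.
    have -> : k - w = - y by rewrite opprB.
    have -> : k + t *: l - w = t *: l - y by rewrite opprB addrA [k + _]addrC.
    rewrite dotv_sqrB lerDr => h.
    by move: h; rewrite pmulr_rge0// subr_ge0.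
  rewrite leNgt; apply/negP => ly.
  have l0 := dotvv_ge0 l.
  (* With this [t], [t * dotv l l] is below [dotv l y], which contradicts [Kt]. *)
  pose t := dotv l y / (dotv l l + 1).
  have t0 : 0 < t by rewrite divr_gt0// ltr_wpDl.
  have := Kt t t0.
  have tE : t * (dotv l l + 1) = dotv l y by rewrite /t divfK// lt0r_neq0// ltr_wpDl.
  by move: tE t0 ly; lra.
suff y0 : y = 0 by move: (subr0_eq y0) => ->.
suff : - y = 0 by move/eqP; rewrite oppr_eq0 => /eqP.
(* The generator with [u = y *m J^T] and [d = z] gives [|y J^T|^2 <= 0]. *)
have yJ : y *m J^T = 0.
  apply: dotvv_le0; rewrite -dotv_mulmx; apply: Ky.
  by exists (1, y *m J^T, z); split=> //=; rewrite subrr subr0 scale1r.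
apply: cq; last by rewrite mulNmx yJ oppr0.
(* The generator with [u = 0] is [- (d - z)], so [- y] lies in the normal cone. *)
move=> d Dd; rewrite dotvNl dotvC -dotvNl; apply: Ky.
by exists (1, 0, d); split=> //=; rewrite mul0mx sub0r scale1r.
Qed.

(** * Positive weights and a left inverse from the dense cone *)

Lemma mulmx_const1E {R : realType} {k : nat} (v : 'rV[R]_k) :
  v *m const_mx 1 = (\sum_i v ord0 i)%:M :> 'M[R]_1.
Proof.
apply/matrixP => i j; rewrite !ord1 !mxE mulr1n.
by apply: eq_bigr => l _; rewrite mxE mulr1.
Qed.

(** The rows of [P] are close to the [e_j], then to the [- e_j]. Weights 1 on the second half and
    [b = - o P2 P1^-1] on the first cancel [P], and [b] is close to [o], hence positive; [B] inverts
    the first half alone. *)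
Lemma positive_spanning_weights {R : realType} {m : nat} (P : 'M[R]_(m + m, m)) :
  m%:R * `|usubmx P - 1%:M| <= 8^-1 -> m%:R * `|dsubmx P + 1%:M| <= 8^-1 ->
  exists (a : 'rV[R]_(m + m)) (B : 'M[R]_(m, m + m)),
    [/\ forall i, 0 < a ord0 i, a *m P = 0 & B *m P = 1%:M].
Proof.
set P1 := usubmx P; set P2 := dsubmx P => h1 h2.
have P1n (v : 'rV[R]_m) : `|v| <= 2 * `|v *m P1|.
  apply: near_id_norm_le; rewrite -{1}[v]mulmx1 -mulmxBr -opprB mulmxN normrN.
  rewrite (le_trans (mulmx_norm_le _ _))// ler_wpM2r//; move: h1; lra.
have P1u := unitmx_of_norm_le P1n.
pose o : 'rV[R]_m := const_mx 1.
have o1 : `|o| <= 1 by apply: mx_norm_le => // i j; rewrite mxE normr1.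
pose b := - (o *m P2) *m invmx P1.
have bP : b *m P1 = - (o *m P2) by rewrite mulmxKV.
(* The error is at most [2 (1/8 + 1/8)], so the entries of [b] are at least 1/2. *)
have bo : `|b - o| <= 2^-1.
  rewrite (le_trans (P1n _))//.
  have -> : (b - o) *m P1 = - (o *m (P2 + 1%:M) + o *m (P1 - 1%:M)).
    by rewrite mulmxBl bP -mulmxDr addrACA subrr addr0 mulmxDr opprD.
  rewrite normrN.
  have := le_trans (mulmx_norm_le o (P2 + 1%:M)) (ler_pM _ _ h2 o1).
  have := le_trans (mulmx_norm_le o (P1 - 1%:M)) (ler_pM _ _ h1 o1).
  rewrite !mulr_ge0// => /(_ isT (normr_ge0 _)) e1 /(_ isT (normr_ge0 _)) e2.
  have := ler_normD (o *m (P2 + 1%:M)) (o *m (P1 - 1%:M)).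
  by move: e1 e2; lra.
have b0 j : 0 < b ord0 j.
  have := le_trans (mx_entry_le (b - o) ord0 j) bo.
  by rewrite !mxE ler_norml; lra.
exists (row_mx b o), (row_mx (invmx P1) 0); split.
- move=> i; rewrite mxE; case: splitP => j _ //.
  by rewrite mxE.
- by rewrite -[P]vsubmxK mul_row_col bP addNr.
- by rewrite -[P]vsubmxK mul_row_col mul0mx addr0 mulVmx.
Qed.

(** Density supplies rows close to the [e_j] and [- e_j], and their scalars are absorbed into the
    weights. Weights at least 1 dominate a small correction [s B], and [B 1 = 0] keeps that
    correction out of the total weight. *)
Lemma constraint_qualification_weights {R : realType} {n m : nat}
    (D : set 'rV[R]_m) (z : 'rV[R]_m) (J : 'M[R]_(n, m)) :
  convex_stable D -> D z ->
  (forall y, normal_cone D z y -> y *m J^T = 0 -> y = 0) ->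
  exists (k : nat) (u : 'M[R]_(k, n)) (d : 'M[R]_(k, m))
         (a : 'rV[R]_k) (B : 'M[R]_(m, k)),
    [/\ (forall i, D (row i d)), (forall i, 1 <= a ord0 i),
        a *m u *m J - a *m d + (\sum_i a ord0 i) *: z = 0,
        B *m u *m J - B *m d = 1%:M & B *m const_mx 1 = 0 :> 'cV[R]_m].
Proof.
move=> cD Dz cq.
pose e : R := 8^-1 / (m%:R + 1).
have m1 : 0 < m%:R + 1 :> R by rewrite ltr_wpDl.
have e0 : 0 < e by rewrite divr_gt0.
have me : m%:R * e <= 8^-1.
  by rewrite /e mulrCA ler_piMr// ler_pdivrMr// mul1r lerDl.
have dense w := constraint_qualification_dense cD Dz cq w e0.
have [f fP] := choice (fun i : 'I_(m + m) =>
  dense (row i (col_mx 1%:M (- 1%:M)))).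
pose r := \row_i (f i).1.1; pose u := \matrix_i (f i).1.2; pose d := \matrix_i (f i).2.
pose K := u *m J - d + const_mx 1 *m z.
pose P := diag_mx r *m K.
have KE i : row i K = (f i).1.2 *m J - ((f i).2 - z).
  have r1 : row i (const_mx 1 : 'cV[R]_(m + m)) = 1%:M.
    by apply/matrixP => x y; rewrite !ord1 !mxE.
  rewrite /K [LHS]linearD/= [X in X + _ = _]linearB/= !row_mul !rowK r1.
  by rewrite mul1mx opprB addrA addrAC.
have Pe i j : `|P i j - col_mx 1%:M (- 1%:M) i j| <= e.
  have [_ _] := fP i; rewrite -KE => /ltW h.
  rewrite distrC; apply: le_trans h.
  have := mx_entry_le (row i (col_mx 1%:M (- 1%:M)) - (f i).1.1 *: row i K) ord0 j.
  by rewrite /P mul_diag_mx !mxE.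
have [||a [B [a0 aP BP]]] := @positive_spanning_weights R m P.
- apply: le_trans me; rewrite ler_wpM2l//; apply: mx_norm_le => [|i j]; first exact: ltW.
  by have := Pe (lshift m i) j; rewrite col_mxEu !mxE.
- apply: le_trans me; rewrite ler_wpM2l//; apply: mx_norm_le => [|i j]; first exact: ltW.
  by have := Pe (rshift m i) j; rewrite col_mxEd !mxE opprK.
pose a1 := a *m diag_mx r; pose B1 := B *m diag_mx r.
have a1K : a1 *m K = 0 by rewrite -mulmxA.
have B1K : B1 *m K = 1%:M by rewrite -mulmxA.
have a10 i : 0 < a1 ord0 i.
  by rewrite /a1 mul_mx_diag mxE mulr_gt0// mxE; have [] := fP i.
(* The term of index [i] alone brings the rescaled weight [i] up to 1. *)
pose c := \sum_i (a1 ord0 i)^-1.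
pose a2 := c *: a1.
have a2K : a2 *m K = 0 by rewrite -scalemxAl a1K scaler0.
have a21 i : 1 <= a2 ord0 i.
  rewrite mxE /c (bigD1 i)//= mulrDl mulVf ?gt_eqF// lerDl mulr_ge0 ?(ltW (a10 i))//.
  by apply: sumr_ge0 => j _; rewrite invr_ge0 ltW.
pose s := \sum_i a2 ord0 i.
(* Subtracting a multiple of [a2] from each row cancels the row sums; [a2 *m K = 0] preserves the
   product with [K]. *)
pose B2 := B1 - s^-1 *: (B1 *m const_mx 1 *m a2).
have B21 : B2 *m const_mx 1 = 0 :> 'cV[R]_m.
  case: (posnP m) => [mE|m_gt0]; first by apply/matrixP => -[i hi]; exfalso; move: hi; rewrite mE.
  have s0 : s != 0.
    rewrite gt_eqF// /s (bigD1 (lshift m (Ordinal m_gt0)))//= ltr_pwDl//.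
      exact: lt_le_trans ltr01 (a21 _).
    by apply: sumr_ge0 => i _; rewrite (le_trans ler01).
  rewrite mulmxBl -scalemxAl -[B1 *m const_mx 1 *m a2 *m _]mulmxA mulmx_const1E.
  by rewrite -/s mul_mx_scalar scalerA mulVf// scale1r subrr.
have B2K : B2 *m K = 1%:M.
  by rewrite mulmxBl B1K -scalemxAl -[_ *m a2 *m K]mulmxA a2K mulmx0 scaler0 subr0.
exists (m + m)%N, u, d, a2, B2; split=> //.
- by move=> i; rewrite rowK; have [] := fP i.
- move: a2K; rewrite /K mulmxDr mulmxBr !mulmxA mulmx_const1E mul_scalar_mx.
  exact.
- by move: B2K; rewrite /K mulmxDr mulmxBr !mulmxA B21 mul0mx addr0.
Qed.

(** * Convex combinations in [D] *)

Lemma convex_set_stable {R : realType} {m : nat} (D : set 'rV[R]_m) :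
  convex_set (D : set (convex_lmodType _)) -> convex_stable D.
Proof.
move=> cD x y t /andP[t0 t1] Dx Dy.
by have := @cD x y (Itv01 t0 t1); rewrite !inE => /(_ Dx Dy).
Qed.

(** The point is [(1 - sum l_i) p + sum l_i d_i]. The induction carries a total mass [c] in place of
    1, so that the tail of the list is treated with mass [c - l_i]. *)
Lemma convex_stable_comb {R : realType} {k m : nat} (D : set 'rV[R]_m)
    (p : 'rV[R]_m) (d : 'M[R]_(k, m)) (l : 'rV[R]_k) :
  convex_stable D -> D p -> (forall i, D (row i d)) ->
  (forall i, 0 <= l ord0 i) -> \sum_i l ord0 i <= 1 ->
  D (p + l *m d - (\sum_i l ord0 i) *: p).
Proof.
move=> cD Dp Dd l0 l1.
have key (r : seq 'I_k) (c : R) : \sum_(i <- r) l ord0 i <= c ->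
    exists2 x, D x &
      c *: p + \sum_(i <- r) l ord0 i *: (row i d - p) = c *: x.
  elim: r c => [|i r IH] c; first by rewrite !big_nil addr0; exists p.
  rewrite !big_cons -lerBrDl => hc; have [x Dx xE] := IH _ hc.
  have S0 : 0 <= \sum_(j <- r) l ord0 j by apply: sumr_ge0.
  have lc : l ord0 i <= c by rewrite -subr_ge0 (le_trans S0).
  have E : c *: p + (l ord0 i *: (row i d - p) +
      \sum_(j <- r) l ord0 j *: (row j d - p)) =
      l ord0 i *: row i d + (c - l ord0 i) *: x.
    by rewrite -xE; apply/matrixP => a b; rewrite !mxE; ring.
  have [c0|c0] := eqVneq c 0.
    have li0 : l ord0 i = 0 by apply/eqP; rewrite eq_le l0 -c0 lc.
    by exists p => //; rewrite E li0 c0 subrr !scale0r addr0.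
  have cp : 0 < c by rewrite lt_neqAle eq_sym c0 (le_trans (l0 i)).
  exists (l ord0 i / c *: row i d + (1 - l ord0 i / c) *: x).
    apply: cD => //; apply/andP; split; first by rewrite divr_ge0// ltW.
    by rewrite ler_pdivrMr// mul1r.
  rewrite E scalerDr !scalerA mulrBr mulr1; congr (_ *: _ + _ *: _); by field.
have [x Dx] := key (index_enum 'I_k) 1 l1.
rewrite !scale1r => xE; suff -> : p + l *m d - (\sum_i l ord0 i) *: p = x by [].
rewrite -xE -addrA; congr (_ + _); under [RHS]eq_bigr do rewrite scalerBr.
by rewrite sumrB -scaler_suml mulmx_sum_row.
Qed.

(** * The curve joining [x] to [x'] *)

Lemma is_derive_poly_scale {R : realType} {n : nat} (p : {poly R})
    (v : 'rV[R]_n) (t : R) :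
  is_derive t 1 (fun s => p.[s] *: v) (p^`().[t] *: v).
Proof.
apply: near_is_derive => e e0.
have e1 : 0 < e / (`|v| + 1) by rewrite divr_gt0// ltr_wpDl.
have := is_derive_near (is_derive_poly p t) e1; apply: filterS => s h.
rewrite scalerA -!scalerBl normrZ (le_trans (ler_wpM2r (normr_ge0 v) h))//.
rewrite mulrAC ler_wpM2r// mulrAC ler_pdivrMr ?ltr_wpDl//.
by rewrite mulrDr mulr1 lerDl ltW.
Qed.

Lemma continuous_poly_scale {R : realType} {n : nat} (p : {poly R})
    (v : 'rV[R]_n) : continuous (fun s => p.[s] *: v).
Proof.
move=> t; have [df _] := is_derive_poly_scale p v t.
exact/differentiable_continuous/derivable1_diffP.
Qed.

(* [ka], [ta] and [et] control, in this order, the size of the bump [mu] that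
   creates slack in [D], the linearization error of [F], and the radius of the
   neighborhood. Here [al], [sg], [nu], [be] only depend on the weights. *)
Section connecting_curve.
Variables (R : realType) (n m k : nat) (F : 'rV[R]_n -> 'rV[R]_m).
Variables (D : set 'rV[R]_m) (xb : 'rV[R]_n) (z : 'rV[R]_m) (J : 'M[R]_(n, m)).
Variables (u : 'M[R]_(k, n)) (d : 'M[R]_(k, m)) (a : 'rV[R]_k) (B : 'M[R]_(m, k)).
Let au := a *m u.
Let ad := a *m d.
Let sg := \sum_i a ord0 i.
Let N := B *m u.
Let E := B *m d.
Let al := `|au|.
Let nu := m%:R * `|N|.
Let be := m%:R * `|B|.
Hypothesis cD : convex_stable D.
Hypothesis Dd : forall i, D (row i d).
Hypothesis a1 : forall i, 1 <= a ord0 i.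
Hypothesis aJ : au *m J - ad + sg *: z = 0.
Hypothesis NJE : N *m J - E = 1%:M.
Hypothesis B1 : B *m const_mx 1 = 0 :> 'cV[R]_m.
Variables (dl ta ka et : R).
Hypothesis ka_gt0 : 0 < ka.
Hypothesis ka1 : ka <= 1.
Hypothesis kasg : ka * sg <= 1.
Hypothesis ta_gt0 : 0 < ta.
Hypothesis tanu : 2 * nu * ta <= 1.
Hypothesis tabe : ta * (2 * be * (4 + 2 * al + sg)) <= ka.
Hypothesis et_dl : et * (13 + 8 * al + 20 * sg) < dl.
Hypothesis et1 : 2 * et <= 1.
Hypothesis FJ : forall y : 'rV[R]_n, `|y - xb| < dl ->
  [/\ differentiable F y, {for y, continuous (fun z => jacobian F z)} &
      forall v : 'rV[R]_n, `|v *m (jacobian F y - J)| <= ta * `|v|].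
Hypothesis Fstrict : forall y y' : 'rV[R]_n, `|y - xb| < dl -> `|y' - xb| < dl ->
  `|F y - F y' - (y - y') *m J| <= ta * `|y - y'|.
Variables (x x' : 'rV[R]_n).
Hypothesis xP : `|x - xb| <= et.
Hypothesis x'P : `|x' - xb| <= et.
Hypothesis FxP : `|F x - z| <= ta.
Hypothesis Fx'P : `|F x' - z| <= ta.
Hypothesis DFx : D (F x).
Hypothesis DFx' : D (F x').

Let v : 'rV[R]_n := x' - x.
Let v' : 'rV[R]_m := F x' - F x.
Let h := `|v|.
Let mu (t : R) := ka * h * (t * (1 - t)).
Let p (t : R) : 'rV[R]_m := F x + t *: v'.
Let c (t : R) : 'rV[R]_n := x + t *: v + mu t *: au.
(** Target for [F] before correction: [p t] moved along the [d_i - p t] with weights [mu t *: a]. *)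
Let q (t : R) : 'rV[R]_m := p t + mu t *: (ad - sg *: p t).
Let U : set R := `]-1, 2[.

Let al0 : 0 <= al. Proof. exact: normr_ge0. Qed.
Let nu0 : 0 <= nu. Proof. by rewrite mulr_ge0. Qed.
Let be0 : 0 <= be. Proof. by rewrite mulr_ge0. Qed.
Let h0 : 0 <= h. Proof. exact: normr_ge0. Qed.
Let et0 : 0 <= et. Proof. exact: le_trans xP. Qed.
Let sg0 : 0 <= sg.
Proof. by apply: sumr_ge0 => i _; rewrite (le_trans ler01). Qed.

Let h_le : h <= 2 * et.
Proof.
rewrite /h /v; have := ler_normB (x' - xb) (x - xb).
have -> : x' - xb - (x - xb) = x' - x by rewrite opprB addrA subrK.
by move: xP x'P; lra.
Qed.

Let et_lt_dl : et < dl.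
Proof.
apply: le_lt_trans et_dl; rewrite ler_peMr//.
by move: al0 sg0; lra.
Qed.

Let bx : `|x - xb| < dl. Proof. exact: le_lt_trans et_lt_dl. Qed.
Let bx' : `|x' - xb| < dl. Proof. exact: le_lt_trans et_lt_dl. Qed.

Let auJ : au *m J = ad - sg *: z.
Proof. by move: aJ => /eqP; rewrite addr_eq0 => /eqP/(canRL (subrK _)) ->; rewrite addrC. Qed.

Let err_v : `|v' - v *m J| <= ta * h.
Proof. exact: Fstrict. Qed.

Let cxE (t : R) : c t - x = t *: v + mu t *: au.
Proof. by rewrite /c; apply/matrixP => i j; rewrite !mxE; ring. Qed.

Let cx'E (t : R) : c t - x' = (t - 1) *: v + mu t *: au.
Proof. by rewrite /c /v; apply/matrixP => i j; rewrite !mxE; ring. Qed.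

(** Expansion at [x]. By [auJ] the first-order effect of the bump cancels, except that [q] has [p t]
    where the linearization has [z]; hence the last summand. *)
Let Fcq_left (t : R) : F (c t) - q t =
  (F (c t) - F x - (c t - x) *m J) - t *: (v' - v *m J) + (mu t * sg) *: (p t - z).
Proof.
have -> : (c t - x) *m J = t *: (v *m J) + mu t *: (ad - sg *: z).
  by rewrite cxE mulmxDl -!scalemxAl auJ.
rewrite /q /p; move: (v *m J) => vJ.
by apply/matrixP => i j; rewrite !mxE; ring.
Qed.

(** Expansion at [x'], whose errors vanish at [t = 1]. *)
Let Fcq_right (t : R) : F (c t) - q t =
  (F (c t) - F x' - (c t - x') *m J) + (1 - t) *: (v' - v *m J) +
  (mu t * sg) *: (p t - z).
Proof.
have -> : (c t - x') *m J = (t - 1) *: (v *m J) + mu t *: (ad - sg *: z).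
  by rewrite cx'E mulmxDl -!scalemxAl auJ.
rewrite /q /p /v'; move: (v *m J) => vJ.
by apply/matrixP => i j; rewrite !mxE; ring.
Qed.

Let c_left (t : R) : `|c t - x| <= `|t| * h + `|mu t| * al.
Proof.
by rewrite cxE (le_trans (ler_normD _ _))// !normrZ.
Qed.

Let c_right (t : R) : `|c t - x'| <= `|1 - t| * h + `|mu t| * al.
Proof.
by rewrite cx'E (le_trans (ler_normD _ _))// !normrZ distrC.
Qed.

Let v'_le : `|v'| <= 2 * ta.
Proof.
have -> : v' = (F x' - z) - (F x - z) by rewrite opprB addrA subrK.
by rewrite (le_trans (ler_normB _ _))//; move: FxP Fx'P; lra.
Qed.

Let ka_h : ka * h <= h. Proof. by rewrite ler_piMl. Qed.
Let ka_h0 : 0 <= ka * h. Proof. by rewrite mulr_ge0// ltW. Qed.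

Let muU (t : R) : U t -> `|t| <= 2 /\ `|mu t| <= 2 * h.
Proof.
rewrite /U/= in_itv/= => /andP[t1 t2]; split; first by rewrite ler_norml; lra.
have tt : `|t * (1 - t)| <= 2 by rewrite ler_norml; nra.
rewrite /mu normrM (ger0_norm ka_h0) (le_trans (ler_wpM2l ka_h0 tt))//.
by move: ka_h; lra.
Qed.

Let mu01 (t : R) : 0 <= t <= 1 -> 0 <= mu t <= h * (t * (1 - t)).
Proof.
move=> /andP[t0 t1]; have tt : 0 <= t * (1 - t) by rewrite mulr_ge0// subr_ge0.
by rewrite /mu mulr_ge0//= ler_wpM2r.
Qed.

Let cU (t : R) : U t -> `|c t - xb| <= et * (5 + 4 * al).
Proof.
move=> /muU[t2 mu2]; have := ler_normD (c t - x) (x - xb).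
rewrite addrA subrK; have := c_left t.
have := ler_wpM2r h0 t2; have := ler_wpM2r al0 mu2; have := ler_wpM2r al0 h_le.
by move: h_le xP; lra.
Qed.

Let pU (t : R) : U t -> `|p t - z| <= 5 * ta.
Proof.
move=> /muU[t2 _]; have -> : p t - z = (F x - z) + t *: v' by rewrite /p addrAC.
have := ler_normD (F x - z) (t *: v'); rewrite normrZ.
have := ler_pM (normr_ge0 t) (normr_ge0 v') t2 v'_le.
by move: FxP; lra.
Qed.

Let cU_dl (t : R) : U t -> `|c t - xb| < dl.
Proof.
move=> Ut; apply: le_lt_trans et_dl; apply: le_trans (cU Ut) _.
by rewrite ler_wpM2l//; move: al0 sg0; lra.
Qed.

(** A coarse bound on all of [U], which places the solution [s] in the ball of radius [dl]. *)
Let Fcq_U (t : R) : U t -> `|F (c t) - q t| <= et * ta * (8 + 4 * al + 20 * sg).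
Proof.
move=> Ut; have [t2 mu2] := muU Ut; rewrite Fcq_left.
have ta0 := ltW ta_gt0.
have e1 : `|F (c t) - F x - (c t - x) *m J| <= ta * (2 * h + 2 * h * al).
  apply: le_trans (Fstrict (cU_dl Ut) bx) _; rewrite ler_wpM2l//.
  by apply: le_trans (c_left t) _; rewrite lerD// ler_wpM2r.
have e2 : `|t *: (v' - v *m J)| <= 2 * (ta * h) by rewrite normrZ ler_pM.
have e3 : `|(mu t * sg) *: (p t - z)| <= 2 * h * sg * (5 * ta).
  by rewrite normrZ normrM (ger0_norm sg0) ler_pM ?mulr_ge0// ?ler_wpM2r// pU.
apply: (@le_trans _ _ (h * (ta * (4 + 2 * al + 10 * sg)))).
  apply: le_trans (ler_normD _ _) _; apply: le_trans (lerD (ler_normB _ _) e3) _.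
  by move: e1 e2; lra.
have w0 : 0 <= ta * (4 + 2 * al + 10 * sg) by rewrite mulr_ge0//; move: al0 sg0; lra.
by have := ler_wpM2r w0 h_le; lra.
Qed.

Let p01 (t : R) : 0 <= t <= 1 -> `|p t - z| <= ta.
Proof.
move=> /andP[t0 t1].
have -> : p t - z = (1 - t) *: (F x - z) + t *: (F x' - z).
  by rewrite /p /v'; apply/matrixP => i j; rewrite !mxE; ring.
have t1' : 0 <= 1 - t by rewrite subr_ge0.
rewrite (le_trans (ler_normD _ _))// !normrZ !ger0_norm//.
have := ler_wpM2l t0 Fx'P; have := ler_wpM2l t1' FxP.
by lra.
Qed.

Let sub01 (t : R) : 0 <= t <= 1 -> U t.
Proof. by rewrite /U/= in_itv/= => /andP[t0 t1]; apply/andP; split; lra. Qed.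

(** The factor [t * (1 - t)] comes from expanding at the nearer endpoint: [t <= 2 t (1 - t)] for
    [t <= 1/2], and symmetrically on the other half. *)
Let Fcq_01 (t : R) : 0 <= t <= 1 ->
  `|F (c t) - q t| <= ta * (h * (t * (1 - t))) * (4 + 2 * al + sg).
Proof.
move=> t01; have /andP[mu0 mu1] := mu01 t01; have Ut := sub01 t01.
have /andP[t0 t1] := t01; have ta0 := ltW ta_gt0.
have t1' : 0 <= 1 - t by rewrite subr_ge0.
set H := h * (t * (1 - t)) in mu1 *.
have H0 : 0 <= H by rewrite /H !mulr_ge0.
have e3 : `|(mu t * sg) *: (p t - z)| <= H * sg * ta.
  rewrite normrZ normrM (ger0_norm sg0) (ger0_norm mu0).
  apply: ler_pM => //; first exact: mulr_ge0; first exact: ler_wpM2r.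
  exact: p01.
have Hal : ta * (mu t * al) <= ta * (H * al) by rewrite ler_wpM2l// ler_wpM2r.
have Hal0 : 0 <= ta * (H * al) by rewrite !mulr_ge0.
have [th|th] := leP t 2^-1.
  have tH : ta * (t * h) <= ta * (2 * H).
    rewrite ler_wpM2l// /H mulrCA -[t * h]mulrC ler_wpM2l//.
    by rewrite mulrCA ler_peMr//; lra.
  have e1 : `|F (c t) - F x - (c t - x) *m J| <= ta * (t * h + mu t * al).
    apply: le_trans (Fstrict (cU_dl Ut) bx) _; rewrite ler_wpM2l//.
    by apply: le_trans (c_left t) _; rewrite !ger0_norm.
  have e2 : `|t *: (v' - v *m J)| <= t * (ta * h).
    by rewrite normrZ ger0_norm// ler_wpM2l.
  rewrite Fcq_left; apply: le_trans (ler_normD _ _) _.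
  apply: le_trans (lerD (ler_normB _ _) e3) _.
  by move: e1 e2 tH Hal Hal0; lra.
have tH : ta * ((1 - t) * h) <= ta * (2 * H).
  rewrite ler_wpM2l// /H mulrCA -[(1 - t) * h]mulrC ler_wpM2l//.
  by rewrite mulrA ler_peMl//; lra.
have e1 : `|F (c t) - F x' - (c t - x') *m J| <= ta * ((1 - t) * h + mu t * al).
  apply: le_trans (Fstrict (cU_dl Ut) bx') _; rewrite ler_wpM2l//.
  by apply: le_trans (c_right t) _; rewrite !ger0_norm.
have e2 : `|(1 - t) *: (v' - v *m J)| <= (1 - t) * (ta * h).
  by rewrite normrZ ger0_norm// ler_wpM2l.
rewrite Fcq_right; apply: le_trans (ler_normD _ _) _.
apply: le_trans (lerD (ler_normD _ _) e3) _.
by move: e1 e2 tH Hal Hal0; lra.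
Qed.

Let ball_dl : set 'rV[R]_n := [set y | `|y - xb| < dl].

Let nuP (s : 'rV[R]_m) : `|s *m N| <= nu * `|s|.
Proof. exact: mulmx_norm_le. Qed.

Let wnu : ta * nu <= 2^-1.
Proof. by move: tanu; lra. Qed.

Let implicit_s : exists s : R -> 'rV[R]_m, forall t, U t ->
  [/\ ball_dl (c t + s t *m N), F (c t + s t *m N) = q t + s t *m E &
      `|s t| <= 2 * `|F (c t) - q t|].
Proof.
(* Twice the coarse bound. By [tanu], the displacement [s N] adds at most [et * (8 + 4 al + 20 sg)]
   to the [et * (5 + 4 al)] of [cU], which totals the left side of [et_dl]. *)
pose r := 2 * (et * ta * (8 + 4 * al + 20 * sg)).
have rB t (s : 'rV[R]_m) : U t -> `|s| <= r -> ball_dl (c t + s *m N).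
  move=> Ut sr; rewrite /ball_dl/= addrAC; apply: le_lt_trans et_dl.
  apply: le_trans (ler_normD _ _) _.
  have := le_trans (nuP s) (ler_wpM2l nu0 sr); have := cU Ut.
  have w0 : 0 <= et * (8 + 4 * al + 20 * sg).
    by rewrite mulr_ge0//; move: al0 sg0; lra.
  by have := ler_wpM2r w0 tanu; rewrite /r; lra.
suff /choice[s sP] : forall t, exists s : 'rV[R]_m, U t ->
    [/\ ball_dl (c t + s *m N), F (c t + s *m N) = q t + s *m E &
      `|s| <= 2 * `|F (c t) - q t|].
  by exists s.
move=> t; have [Ut|nUt] := pselect (U t); last by exists 0.
have Fr : 2 * `|F (c t) - q t| <= r by rewrite ler_wpM2l// Fcq_U.
have [|s sE sle] := implicit_point (ltW ta_gt0) nuP wnu NJE Fstrict Fr.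
  by move=> s sr; exact: rB.
by exists s => _; split=> //; apply: rB => //; exact: le_trans sle Fr.
Qed.

(** The bump [mu] as a polynomial, which makes [c] and [q] explicitly C1. *)
Let pm : {poly R} := (ka * h) *: ('X * (1%:P - 'X)).
Let dmu (t : R) := ka * h * (1 - 2 * t).

Let pmE (t : R) : pm.[t] = mu t.
Proof. by rewrite /pm /mu !hornerE; ring. Qed.

Let dpmE (t : R) : pm^`().[t] = dmu t.
Proof. by rewrite /pm /dmu derivZ derivM derivB derivC derivX !hornerE; ring. Qed.

Let XpmE (t : R) : ('X * pm).[t] = t * mu t.
Proof. by rewrite hornerM hornerX pmE. Qed.

Let dXpmE (t : R) : ('X * pm)^`().[t] = mu t + t * dmu t.
Proof. by rewrite derivM derivX mul1r hornerD hornerM hornerX pmE dpmE. Qed.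

Let dc (t : R) : 'rV[R]_n := v + pm^`().[t] *: au.
Let dq (t : R) : 'rV[R]_m := v' + pm^`().[t] *: (ad - sg *: F x) +
  ('X * pm)^`().[t] *: (- (sg *: v')).

Let is_derive_c (t : R) : is_derive t 1 c (dc t).
Proof.
have -> : c = (fun s : R => x + s *: v) + (fun s => pm.[s] *: au).
  by apply/funext => s; rewrite /c !fctE pmE.
by apply: is_deriveD; [exact: is_derive_segment|exact: is_derive_poly_scale].
Qed.

Let is_derive_q (t : R) : is_derive t 1 q (dq t).
Proof.
have -> : q = (fun s : R => F x + s *: v') + (fun s => pm.[s] *: (ad - sg *: F x)) +
    (fun s => ('X * pm).[s] *: (- (sg *: v'))).
  apply/funext => s; rewrite /q /p !fctE XpmE pmE.
  by apply/matrixP => i j; rewrite !mxE; ring.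
have d1 := is_derive_poly_scale pm (ad - sg *: F x) t.
have d2 := is_derive_poly_scale ('X * pm) (- (sg *: v')) t.
exact: (is_deriveD (is_deriveD (is_derive_segment (F x) v' t) d1) d2).
Qed.

Let continuous_dc (t : R) : {for t, continuous dc}.
Proof.
have c1 := @continuous_poly_scale R n (pm^`()) au t.
exact: (cvgD (cvg_cst v) c1).
Qed.

Let continuous_dq (t : R) : {for t, continuous dq}.
Proof.
have c1 := @continuous_poly_scale R m (pm^`()) (ad - sg *: F x) t.
have c2 := @continuous_poly_scale R m (('X * pm)^`()) (- (sg *: v')) t.
exact: (cvgD (cvgD (cvg_cst v') c1) c2).
Qed.

Let dmu01 (t : R) : 0 <= t <= 1 -> `|dmu t| <= ka * h.
Proof.
move=> /andP[t0 t1]; rewrite /dmu normrM (ger0_norm ka_h0) ler_piMr//.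
by rewrite ler_norml; lra.
Qed.

(** After cancellation by [auJ], every summand has a factor of order [ta]: [v' - v J], [G - J],
    [p t - z] or [v']. *)
Let dq_dc (t : R) (G : 'M[R]_(n, m)) : 0 <= t <= 1 ->
  (forall w : 'rV[R]_n, `|w *m (G - J)| <= ta * `|w|) ->
  `|dq t - dc t *m G| <= ta * h * (2 + 3 * sg + al).
Proof.
move=> t01 GJ; have /andP[mu0 mu1] := mu01 t01; have /andP[t0 t1] := t01.
have ta0 := ltW ta_gt0.
have -> : dq t - dc t *m G = (v' - v *m J) - v *m (G - J) -
    (dmu t * sg) *: (p t - z) - dmu t *: (au *m (G - J)) - (mu t * sg) *: v'.
  rewrite /dq /dc dXpmE dpmE !mulmxBr auJ mulmxDl -scalemxAl /p.
  move: (v *m G) (v *m J) (au *m G) => vG vJ auG.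
  by apply/matrixP => i j; rewrite !mxE; ring.
have dm : `|dmu t| <= h by exact: le_trans (dmu01 t01) ka_h.
have muh : mu t <= h.
  apply: (le_trans mu1); rewrite ler_piMr//; nra.
have e1 := err_v; have e2 := GJ v.
have e3 : `|(dmu t * sg) *: (p t - z)| <= h * sg * ta.
  rewrite normrZ normrM (ger0_norm sg0).
  apply: ler_pM => //; first exact: mulr_ge0; first exact: ler_wpM2r.
  exact: p01.
have e4 : `|dmu t *: (au *m (G - J))| <= h * (ta * al).
  by rewrite normrZ; apply: ler_pM => //; exact: GJ.
have e5 : `|(mu t * sg) *: v'| <= h * sg * (2 * ta).
  rewrite normrZ normrM (ger0_norm sg0) (ger0_norm mu0).
  apply: ler_pM => //; first exact: mulr_ge0.
  exact: ler_wpM2r.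
apply: le_trans (ler_normB _ _) _; apply: le_trans (lerD (ler_normB _ _) e5) _.
apply: le_trans (lerD (lerD (ler_normB _ _) e4) (lexx _)) _.
apply: le_trans (lerD (lerD (lerD (ler_normB _ _) e3) (lexx _)) (lexx _)) _.
by move: e1 e2; rewrite -/h; lra.
Qed.

(* The correction [s] is of smaller order than the bump: both vanish like
   [t * (1 - t)], but the factor of [s] is proportional to [ta]. *)
Let weights_ge0 (t : R) (s : 'rV[R]_m) : 0 <= t <= 1 ->
  `|s| <= 2 * `|F (c t) - q t| -> forall i, 0 <= (mu t *: a + s *m B) ord0 i.
Proof.
move=> t01 sle i; have /andP[t0 t1] := t01; have /andP[mu0 _] := mu01 t01.
have := mx_entry_le (s *m B) ord0 i; rewrite ler_norml => /andP[sB _].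
have sB' : `|s *m B| <= mu t.
  apply: le_trans (mulmx_norm_le _ _) _; rewrite -/be.
  have H0 : 0 <= h * (t * (1 - t)) by rewrite !mulr_ge0// subr_ge0.
  have := ler_wpM2l be0 (le_trans sle (ler_wpM2l (ler0n R 2) (Fcq_01 t01))).
  by have := ler_wpM2r H0 tabe; rewrite /mu; lra.
have := ler_wpM2l mu0 (a1 i); rewrite mulr1.
by rewrite mxE [X in X + _]mxE; move: sB sB'; lra.
Qed.

(** The deviation of the derivative from [x' - x] splits into that of the bump, of order [ka], and
    that of the implicit correction, of order [ta]. *)
Lemma connecting_curve : exists (V : set R) (g : R -> 'rV[R]_n),
  [/\ open V /\ `[0, 1] `<=` V, C1_curve_on V g,
      (forall t : R, 0 <= t <= 1 -> `|g t - xb| < dl /\ D (F (g t))),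
      g 0 = x /\ g 1 = x' &
      forall t : R, 0 <= t <= 1 -> `|'D_1 g t - (x' - x)| <=
        (ka * al + 2 * nu * ta * (2 + 3 * sg + al)) * `|x' - x|].
Proof.
have [s sP] := implicit_s; pose g (t : R) := c t + s t *m N.
have gB t : U t -> ball_dl (g t) by move=> /sP[].
have gF t : U t -> F (g t) = q t + s t *m E by move=> /sP[].
have oU : open U by exact: interval_open.
exists U, g; split.
- by split=> // t; rewrite /= in_itv/= => /sub01.
- exact: (implicit_curve_C1 (ltW ta_gt0) nu0 nuP wnu NJE FJ Fstrict oU
    (fun t _ => is_derive_c t) (fun t _ => is_derive_q t)
    (fun t _ => @continuous_dc t) (fun t _ => @continuous_dq t) gB gF).
- move=> t t01; have Ut := sub01 t01; split; first exact: gB.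
  have /andP[t0 t1] := t01; have /andP[mu0 mu1] := mu01 t01.
  have [_ _ sle] := sP t Ut.
  pose l := mu t *: a + s t *m B.
  have lS : \sum_i l ord0 i = mu t * sg.
    have := mulmx_const1E l; rewrite mulmxDl -scalemxAl -mulmxA B1 mulmx0 addr0.
    rewrite mulmx_const1E => /matrixP/(_ ord0 ord0).
    by rewrite !mxE !mulr1n.
  have Dp : D (p t).
    have -> : p t = t *: F x' + (1 - t) *: F x.
      by rewrite /p /v'; apply/matrixP => i j; rewrite !mxE; ring.
    exact: cD.
  (* The implicit equation reads as a combination of [p t] and the rows of [d], so it remains to
     check nonnegative weights of sum at most 1. *)
  have -> : F (g t) = p t + l *m d - (\sum_i l ord0 i) *: p t.
    rewrite gF// lS /l mulmxDl -scalemxAl -[s t *m B *m d]mulmxA -/E -/ad /q.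
    by apply/matrixP => i j; rewrite !mxE; ring.
  apply: convex_stable_comb => //; first exact: weights_ge0.
  have tt : h * (t * (1 - t)) <= 1.
    have : t * (1 - t) <= 1 by nra.
    have tt0 : 0 <= t * (1 - t) by rewrite mulr_ge0// subr_ge0.
    have h1 : h <= 1 by move: h_le et1; lra.
    by move=> tt1; rewrite (le_trans (ler_pM h0 tt0 h1 tt1))// mulr1.
  have H0 : 0 <= h * (t * (1 - t)) by rewrite !mulr_ge0// subr_ge0.
  rewrite lS /mu; have -> : ka * h * (t * (1 - t)) * sg = ka * sg * (h * (t * (1 - t))).
    by ring.
  have ks0 : 0 <= ka * sg by rewrite mulr_ge0// ltW.
  by rewrite (le_trans (ler_pM ks0 H0 kasg tt))// mulr1.
(* The bound on [s] carries the factor [t * (1 - t)], so the correction vanishes at both ends. *)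
- have s0 t : 0 <= t <= 1 -> t * (1 - t) = 0 -> s t = 0.
    move=> t01 tt; have [_ _] := sP t (sub01 t01).
    have := Fcq_01 t01; rewrite tt !(mulr0, mul0r) => f0 sle.
    apply/normr0_eq0/eqP; rewrite eq_le normr_ge0 andbT.
    by move: f0 sle; lra.
  rewrite /g /c /mu !s0 ?lexx ?ler01// ?subrr ?subr0 ?mulr0 ?mul0r//.
  rewrite ?mulr0 !scale0r !mul0mx !addr0 scale1r; split=> //.
  by rewrite /v addrC subrK.
- move=> t t01; have Ut := sub01 t01.
  have gder := implicit_curve_derive (ltW ta_gt0) nu0 nuP wnu NJE FJ Fstrict oU
    (fun t _ => is_derive_c t) (fun t _ => is_derive_q t)
    gB gF Ut.
  have [_ _ GJ] := FJ (gB t Ut).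
  have := ler_wpM2l nu0 (ler_wpM2l (ler0n R 2) (dq_dc t01 GJ)).
  have : `|dc t - v| <= ka * h * al.
    rewrite /dc addrC addKr dpmE normrZ ler_wpM2r//; exact: dmu01.
  have := ler_normD ('D_1 g t - dc t) (dc t - v); rewrite addrA subrK.
  move: gder; rewrite -/v -/h -/g; lra.
Qed.

End connecting_curve.

(** * Choice of the constants and conclusion *)

(** The constants [ka] and [ta] below are inverses of sums of nonnegative terms; a term [b / e] in
    the sum secures the bound [e] on the product with [b]. *)
Lemma inv_mul_le {R : realType} (b c e : R) :
  0 <= b -> 0 < e -> b / e <= c -> c^-1 * b <= e.
Proof.
move=> b0 e0 bc; have [->|bn0] := eqVneq b 0; first by rewrite mulr0 ltW.
have c0 : 0 < c by apply: lt_le_trans bc; rewrite divr_gt0// lt_neqAle eq_sym bn0.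
by rewrite mulrC ler_pdivrMr// mulrC -ler_pdivrMr.
Qed.

Theorem theorem3p14 (R : realType) (n : nat) (C : set 'rV[R]_n) (xbar : 'rV[R]_n) :
  C xbar -> amenable_at C xbar -> smoothly_approx_convex_at C xbar.
Proof.
move=> Cx [V [m [F [D [[oV Vx] FC1 [clD /convex_set_stable cD] CV cq]]]]] eps eps0.
have inCV y : V y -> C y <-> D (F y).
  move=> Vy; split=> [Cy|Dy]; last by have [] : (C `&` V) y by rewrite CV.
  by have [] : [set x | V x /\ D (F x)] y by rewrite -CV.
have Dz : D (F xbar) by apply/inCV.
have [k [u [d [a [B [Dd a1 aJ NJE B1]]]]]] :=
  constraint_qualification_weights cD Dz cq.
(* Pays for the passage from the maximum norm to the Euclidean norm. *)
pose e1 := eps / (n%:R + 1).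
have n1 : 0 < n%:R + 1 :> R by rewrite ltr_wpDl.
have e10 : 0 < e1 by rewrite divr_gt0.
set J := jacobian F xbar in aJ NJE.
pose al := `|a *m u|; pose sg := \sum_i a ord0 i.
pose nu := m%:R * `|B *m u|; pose be := m%:R * `|B|.
have al0 : 0 <= al by exact: normr_ge0.
have nu0 : 0 <= nu by rewrite mulr_ge0.
have be0 : 0 <= be by rewrite mulr_ge0.
have sg0 : 0 <= sg by apply: sumr_ge0 => i _; rewrite (le_trans ler01).
(* The terms give [ka <= 1], [ka * sg <= 1] and [ka * al <= e1 / 2], the share of the bump in the
   error. *)
pose ka := (1 + sg + 2 * al / e1)^-1.
have al2 : 0 <= 2 * al / e1 by rewrite divr_ge0 ?(ltW e10)// mulr_ge0.
have ka0 : 0 < ka by rewrite invr_gt0; lra.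
have ka1 : ka <= 1 by rewrite invf_le1; lra.
have kasg : ka * sg <= 1 by apply: inv_mul_le; lra.
have kaal : ka * (2 * al) <= e1.
  by apply: inv_mul_le => //; [rewrite mulr_ge0|lra].
pose b1 := 2 * nu; pose b2 := 2 * be * (4 + 2 * al + sg).
pose b3 := 4 * nu * (2 + 3 * sg + al).
have b10 : 0 <= b1 by rewrite mulr_ge0.
have b20 : 0 <= b2 by rewrite !mulr_ge0//; lra.
have b30 : 0 <= b3 by rewrite !mulr_ge0//; lra.
have b2k : 0 <= b2 / ka by rewrite divr_ge0// ltW.
have b3e : 0 <= b3 / e1 by rewrite divr_ge0// ltW.
(* The terms in [b1], [b2], [b3] give the contraction, the dominance of the bump over the
   correction, and the other half of [e1]. *)
pose ta := (1 + b1 + b2 / ka + b3 / e1)^-1.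
have ta0 : 0 < ta by rewrite invr_gt0; lra.
have tab1 : ta * b1 <= 1 by apply: inv_mul_le; lra.
have tab2 : ta * b2 <= ka by apply: inv_mul_le => //; lra.
have tab3 : ta * b3 <= e1 by apply: inv_mul_le => //; lra.
have [dl dl0 [FV Fst]] := C1_strictly_differentiable oV Vx FC1 ta0.
(* The denominator exceeds [13 + 8 al + 20 sg], for [et_dl], and [2 * dl], for [et1]. *)
pose et := dl / (14 + 8 * al + 20 * sg + 2 * dl).
have et0 : 0 < et by rewrite divr_gt0//; lra.
have etE : et * (14 + 8 * al + 20 * sg + 2 * dl) = dl.
  by rewrite /et divfK// gt_eqF//; lra.
have et1 : 2 * et <= 1.
  by rewrite /et mulrA ler_pdivrMr; lra.
have et_dl : et * (13 + 8 * al + 20 * sg) < dl.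
  by rewrite -[ltRHS]etE ltr_pM2l//; lra.
have [dF cJ] := FC1.
have FJ (y : 'rV[R]_n) : `|y - xbar| < dl ->
  [/\ differentiable F y, {for y, continuous (fun z => jacobian F z)} &
      forall v : 'rV[R]_n, `|v *m (jacobian F y - J)| <= ta * `|v|].
  by move=> /FV[Vy H]; split=> //; [exact: dF|exact: cJ].
have cF : {for xbar, continuous F} by apply: differentiable_continuous; exact: dF.
(* The values of [F] are constrained too, as [p t - z] has to be of order [ta]. *)
exists [set y : 'rV[R]_n | `|y - xbar| < et /\ `|F y - F xbar| <= ta]; split.
  have /cvgrPdist_le/(_ _ ta0) nF := cF.
  near=> y; split; last by rewrite distrC; near: y; exact: nF.
  rewrite distrC; near: y.
  by have := nbhsx_ballx xbar et et0; rewrite -ball_normE.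
have etdl : et < dl.
  by apply: le_lt_trans et_dl; rewrite ler_peMr ?(ltW et0)//; lra.
move=> x x' Cx0 [/= xet Fx] Cx' [/= x'et Fx'].
have Dx : D (F x) by apply/inCV => //; have [] := FV x (lt_trans xet etdl).
have Dx' : D (F x') by apply/inCV => //; have [] := FV x' (lt_trans x'et etdl).
have tanu : 2 * nu * ta <= 1 by rewrite mulrC.
have [U [g [UP gC1 gD g01 gder]]] := connecting_curve cD Dd a1 aJ NJE B1 ka0 ka1
  kasg ta0 tanu tab2 et_dl et1 FJ Fst (ltW xet) (ltW x'et) Fx Fx' Dx Dx'.
exists U, g; split=> // t; rewrite in_itv/= => t01.
  by have [gt Dg] := gD t t01; apply/inCV => //; have [] := FV _ gt.
have gt := gder t t01.
apply: le_trans (enorm_le _) _.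
apply: (@le_trans _ _ (eps * `|x' - x|)); last by rewrite ler_wpM2l ?norm_le_enorm// ltW.
have h0 := normr_ge0 (x' - x).
have gt2 : `|'D_1 g t - (x' - x)| <= e1 * `|x' - x|.
  apply: le_trans gt _; rewrite ler_wpM2r//.
  by move: kaal tab3; rewrite /b3 -/al -/sg -/nu; lra.
apply: le_trans (ler_wpM2l (ler0n R n) gt2) _.
rewrite mulrA ler_wpM2r// /e1 mulrCA ler_piMr ?(ltW eps0)//.
by rewrite ler_pdivrMr// mul1r lerDl.
Unshelve. all: by end_near. Qed.
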